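(* Let $R=R_0\oplus R_1$ be a $\mathbb{Z}_2$-graded commutative ring. Then $$\mathbb{Z}_2\mathrm{Max}\,R=\{p+R_1 : p\in\mathrm{Max}\,R_0\cap V(R_1^2)\}\cup\{p+pR_1 : p\in\mathrm{Max}\,R_0\cap D(R_1^2)\}.$$
   Context: $\mathbb{Z}_2=\mathbb{Z}/2\mathbb{Z}$. A $\mathbb{Z}_2$-graded commutative ring is a commutative ring $R$ with unit together with additive subgroups $R_0,R_1$ such that $R=R_0\oplus R_1$ and $R_iR_j\subseteq R_{i+j}$ for all $i,j\in\mathbb{Z}_2$ (products of subgroups mean finite sums of products). Then $R_0$ is a subring, $R_1$ is an $R_0$-module, and $R_1^2:=R_1R_1$ is an ideal of $R_0$. An ideal $I$ of $R$ is $\mathbb{Z}_2$-graded if $I=(I\cap R_0)\oplus(I\cap R_1)$. A $\mathbb{Z}_2$-graded ideal $M\neq R$ is $\mathbb{Z}_2$-graded maximal if for every $\mathbb{Z}_2$-graded ideal $J$ with $M\subseteq J\subseteq R$ one has $J=M$ or $J=R$. $\mathbb{Z}_2\mathrm{Max}\,R$ is the set of $\mathbb{Z}_2$-graded maximal ideals of $R$, and $\mathrm{Max}\,R_0$ is the set of maximal ideals of $R_0$. For an ideal $I$ of $R_0$, $V(I)=\{p\in\mathrm{Spec}\,R_0 : I\subseteq p\}$ and $D(I)=\mathrm{Spec}\,R_0\setminus V(I)$. *)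

(* Defs.v *)
From mathcomp Require Import all_boot all_algebra.
From mathcomp Require Import boolp classical_sets.

Set Implicit Arguments.
Unset Strict Implicit.
Unset Printing Implicit Defensive.

Import GRing.Theory.

Local Open Scope classical_set_scope.
Local Open Scope ring_scope.

Section Defs.

(* [comPzRingType]: commutative unital rings, the zero ring included. *)
Variable R : comPzRingType.
Implicit Types A B C I J M P : set R.

Definition sumset A B : set R := [set a + b | a in A & b in B].

(* Finite sums of products, not just products. *)
Definition mulset A B : set R :=
  [set x | exists (n : nat) (a b : 'I_n -> R),
      [/\ forall i, A (a i), forall i, B (b i) & x = \sum_(i < n) a i * b i]].

(* [C = A (+) B]; meant for additive subgroups, for which uniqueness of the
   decomposition amounts to [A] and [B] meeting in [0] only. *)
Definition direct_sum C A B : Prop := C = sumset A B /\ A `&` B = [set 0].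

Definition Z2_grading (Rg : 'Z_2 -> set R) : Prop :=
  [/\ forall i, zmod_closed (mem (Rg i)),
      direct_sum setT (Rg 0) (Rg 1) &
      forall i j, mulset (Rg i) (Rg j) `<=` Rg (i + j)].

(* [is_ideal A I]: [I] is an ideal of the subring [A] of [R]; ideals of [R]
   itself are obtained with [A := setT], those of [R_0] with [A := Rg 0]. *)
Definition is_ideal A I : Prop :=
  [/\ I `<=` A, zmod_closed (mem I) & forall a x, A a -> I x -> I (a * x)].

Definition is_prime A P : Prop :=
  [/\ is_ideal A P, P <> A &
      forall a b, A a -> A b -> P (a * b) -> P a \/ P b].

Definition is_maximal A M : Prop :=
  [/\ is_ideal A M, M <> A &
      forall J, is_ideal A J -> M `<=` J -> J = M \/ J = A].

Definition Spec A : set (set R) := [set P | is_prime A P].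
Definition Max A : set (set R) := [set M | is_maximal A M].

Definition V A I : set (set R) := [set P | Spec A P /\ I `<=` P].
Definition D A I : set (set R) := Spec A `\` V A I.

Definition Z2_ideal (Rg : 'Z_2 -> set R) I : Prop :=
  is_ideal setT I /\ direct_sum I (I `&` Rg 0) (I `&` Rg 1).

Definition Z2_maximal (Rg : 'Z_2 -> set R) M : Prop :=
  [/\ Z2_ideal Rg M, M <> setT &
      forall J, Z2_ideal Rg J -> M `<=` J -> J = M \/ J = setT].

Definition Z2Max (Rg : 'Z_2 -> set R) : set (set R) :=
  [set M | Z2_maximal Rg M].

End Defs.

(* Main.v *)
Require Import Defs.
From mathcomp Require Import all_boot all_algebra.
From mathcomp Require Import boolp classical_sets.
From mathcomp Require Import ring.

Set Implicit Arguments.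
Unset Strict Implicit.
Unset Printing Implicit Defensive.

Import GRing.Theory.

Local Open Scope classical_set_scope.
Local Open Scope ring_scope.

(** A graded ideal is the same thing as its pair of components [(I0, I1)]: an
    ideal [I0] of [R0] and an [R0]-submodule [I1] of [R1] such that
    [R1 I0 <= I1] and [R1 I1 <= I0].  So for a given [I0] the degree-one
    component ranges between [I0 R1] and [{x in R1 | R1 x <= I0}].

    When [p = I0] is a maximal ideal of [R0], this range explains the two
    families.  If [R1^2 <= p], its largest member is [R1] itself, and [p + R1]
    is the largest graded ideal with even part [p].  If [R1^2] is not inside
    [p], then [p + R1^2 = R0]; writing [1 = a + s] with [a] in [p] and [s] in
    [R1^2], every [x] in [I1] is [a x + s x], where [a x] lies in [p R1] and so
    does [s x], as [x R1 <= p].  The range is thus reduced to [p R1], and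
    [p + p R1] is the only graded ideal with even part [p].  In both cases the
    ideal is graded maximal, since a larger graded ideal has even part [p] or
    [R0], and one whose even part contains [1] is [R]
    ([graded_maximal_of_even_part]).

    Conversely, the even part [p] of a graded maximal ideal [M] is maximal in
    [R0] ([even_part_maximal]): an ideal [q] of [R0] containing [p] is the even
    part of the graded ideal [q + (M1 + q R1)], which contains [M].  Then the
    ideal that the first half attaches to [p] is comparable with [M], hence
    equal to it. *)

(** * Sums and products of subsets of a commutative ring *)

Section Subsets.
Context {R : comPzRingType}.
Implicit Types (A B C I J : set R) (x y : R).

Lemma zmod_closedE A :
  zmod_closed (mem A) <-> A 0 /\ forall x y, A x -> A y -> A (x - y).
Proof.
split=> -[h0 hB]; split.
- by move: h0; rewrite inE.
- by move=> x y hx hy; have := hB x y; rewrite !inE; apply.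
- by rewrite inE.
- by move=> x y; rewrite !inE; apply: hB.
Qed.

Lemma zmod0 {A} : zmod_closed (mem A) -> A 0.
Proof. by move/zmod_closedE => []. Qed.

Lemma zmodB {A} (hA : zmod_closed (mem A)) {x y} : A x -> A y -> A (x - y).
Proof. by move/zmod_closedE: hA => [_]; apply. Qed.

Lemma zmodN {A} (hA : zmod_closed (mem A)) {x} : A x -> A (- x).
Proof. by move=> hx; rewrite -sub0r; apply: (zmodB hA) => //; apply: zmod0. Qed.

Lemma zmodD {A} (hA : zmod_closed (mem A)) {x y} : A x -> A y -> A (x + y).
Proof. by move=> hx /(zmodN hA) hy; rewrite -[y]opprK; apply: (zmodB hA). Qed.

Lemma zmod_closedI A B : zmod_closed (mem A) -> zmod_closed (mem B) ->
  zmod_closed (mem (A `&` B)).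
Proof.
move=> hA hB; apply/zmod_closedE; split; first by split; apply: zmod0.
by move=> x y [Ax Bx] [Ay By]; split; [apply: (zmodB hA)|apply: (zmodB hB)].
Qed.

Lemma zmod_closed_sumset A B : zmod_closed (mem A) -> zmod_closed (mem B) ->
  zmod_closed (mem (sumset A B)).
Proof.
move=> hA hB; apply/zmod_closedE; split.
  by exists 0; [exact: zmod0|exists 0; [exact: zmod0|rewrite addr0]].
move=> _ _ [a Aa [b Bb <-]] [a' Aa' [b' Bb' <-]].
exists (a - a'); first exact: zmodB.
by exists (b - b'); [exact: zmodB|ring].
Qed.

Lemma sumset_subl A B : zmod_closed (mem B) -> A `<=` sumset A B.
Proof.
by move=> hB a Aa; exists a => //; exists 0; [exact: zmod0|rewrite addr0].
Qed.

Lemma sumset_subr A B : zmod_closed (mem A) -> B `<=` sumset A B.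
Proof.
by move=> hA b Bb; exists 0; [exact: zmod0|exists b => //; rewrite add0r].
Qed.

Lemma sumset_sub A B C : zmod_closed (mem C) -> A `<=` C -> B `<=` C ->
  sumset A B `<=` C.
Proof.
by move=> hC hA hB _ [a /hA Ca [b /hB Cb <-]]; apply: (zmodD hC).
Qed.

Lemma mem_mulset {A B x y} : A x -> B y -> mulset A B (x * y).
Proof.
move=> Ax By; exists 1%N, (fun=> x), (fun=> y); split => //.
by rewrite big_ord1.
Qed.

Lemma mulset_sub A B C : zmod_closed (mem C) ->
  (forall x y, A x -> B y -> C (x * y)) -> mulset A B `<=` C.
Proof.
move=> hC hAB _ [n [a [b [Aa Bb ->]]]].
elim/big_ind: _ => [|x y|i _]; [exact: zmod0|exact: zmodD|exact: hAB].
Qed.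

Lemma zmod_closed_mulset A B : zmod_closed (mem A) ->
  zmod_closed (mem (mulset A B)).
Proof.
move=> hA; apply/zmod_closedE; split.
  exists 0%N, (fun=> 0), (fun=> 0); split; try by case.
  by rewrite big_ord0.
move=> _ _ [n [a [b [Aa Bb ->]]]] [m [c [d [Ac Bd ->]]]].
exists (n + m)%N,
  (fun i => match split i with inl j => a j | inr j => - c j end),
  (fun i => match split i with inl j => b j | inr j => d j end).
split.
- by move=> i; case: (split i) => j //; apply: zmodN.
- by move=> i; case: (split i).
rewrite big_split_ord /= -sumrN; congr (_ + _); apply: eq_bigr => i _.
  by rewrite (unsplitK (inl i)).
by rewrite (unsplitK (inr i)) mulNr.
Qed.

Lemma zmod_closed_preim_mul x A : zmod_closed (mem A) ->
  zmod_closed (mem [set y | A (x * y)]).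
Proof.
move=> hA; apply/zmod_closedE; split; first by rewrite /= mulr0; exact: zmod0.
by move=> y z /= hy hz; rewrite mulrBr; apply: zmodB.
Qed.

Lemma mulset_absorb x A B : zmod_closed (mem A) ->
  (forall y, A y -> A (x * y)) ->
  forall y, mulset A B y -> mulset A B (x * y).
Proof.
move=> hA hx; apply: mulset_sub => [|y z Ay Bz].
  by apply: zmod_closed_preim_mul; apply: zmod_closed_mulset.
by rewrite /= mulrA; apply: mem_mulset => //; apply: hx.
Qed.

(** * Ideals of a subring *)

Lemma is_ideal_sumset A I J : zmod_closed (mem A) ->
  is_ideal A I -> is_ideal A J -> is_ideal A (sumset I J).
Proof.
move=> hA [IA hI mI] [JA hJ mJ]; split.
- exact: sumset_sub.
- exact: zmod_closed_sumset.
move=> a _ Aa [x Ix [y Jy <-]]; rewrite mulrDr.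
by exists (a * x); [exact: mI|exists (a * y) => //; exact: mJ].
Qed.

Lemma ideal_eq_of_one A I : is_ideal A I -> I 1 -> I = A.
Proof.
move=> [IA _ mI] I1; rewrite eqEsubset; split=> // a Aa.
by rewrite -[a]mulr1; apply: mI.
Qed.

Lemma is_ideal_principal A a : zmod_closed (mem A) ->
  (forall x y, A x -> A y -> A (x * y)) -> A a ->
  is_ideal A [set r * a | r in A].
Proof.
move=> hA mA Aa; split.
- by move=> _ [r Ar <-]; apply: mA.
- apply/zmod_closedE; split; first by exists 0; [exact: zmod0|rewrite mul0r].
  move=> _ _ [r Ar <-] [s As <-].
  by exists (r - s); [exact: zmodB|rewrite mulrBl].
- by move=> b _ Ab [r Ar <-]; exists (b * r); [exact: mA|rewrite mulrA].
Qed.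

Lemma maximal_comaximal A I J : zmod_closed (mem A) ->
  is_maximal A I -> is_ideal A J -> ~ J `<=` I -> sumset I J = A.
Proof.
move=> hA [iI _ maxI] iJ JI.
case: (maxI (sumset I J)) => //.
- exact: is_ideal_sumset.
- by apply: sumset_subl; case: iJ.
- move=> IJ; case: JI; rewrite -IJ.
  by apply: sumset_subr; case: iI.
Qed.

Lemma maximal_prime A P : zmod_closed (mem A) -> A 1 ->
  (forall x y, A x -> A y -> A (x * y)) -> is_maximal A P -> is_prime A P.
Proof.
move=> hA A1 mA maxP; have [iP nP _] := maxP; split=> // a b Aa Ab Pab.
have [Pa|nPa] := pselect (P a); [by left|right].
have iJ := is_ideal_principal hA mA Aa.
have nJ : ~ [set r * a | r in A] `<=` P.
  by move=> JP; apply: nPa; apply: JP; exists 1 => //; rewrite mul1r.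
have: sumset P [set r * a | r in A] 1.
  by rewrite (maximal_comaximal hA maxP iJ nJ).
case=> x Px [_ [r Ar <-] e].
have [_ hP mP] := iP.
have -> : b = b * x + r * (a * b).
  by rewrite -{1}[b]mulr1 -e; ring.
by apply: (zmodD hP); apply: mP.
Qed.

End Subsets.

(** * Graded ideals and their components *)

Section Graded.
Context {R : comPzRingType} {Rg : 'Z_2 -> set R} (hR : Z2_grading Rg).
Local Notation R0 := (Rg 0).
Local Notation R1 := (Rg 1).
Implicit Types (I J M p q : set R).

Lemma grading_zmod i : zmod_closed (mem (Rg i)).
Proof. by case: hR. Qed.

Lemma gradingM i j x y : Rg i x -> Rg j y -> Rg (i + j) (x * y).
Proof. by case: hR => _ _ h hx hy; apply/h/mem_mulset. Qed.

Lemma gradingM00 x y : R0 x -> R0 y -> R0 (x * y).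
Proof. by move=> hx hy; have := gradingM hx hy; rewrite addr0. Qed.

Lemma gradingM01 x y : R0 x -> R1 y -> R1 (x * y).
Proof. by move=> hx hy; have := gradingM hx hy; rewrite add0r. Qed.

Lemma gradingM11 x y : R1 x -> R1 y -> R0 (x * y).
Proof.
move=> hx hy; have := gradingM hx hy.
by have -> : 1 + 1 = 0 :> 'Z_2 by apply: val_inj.
Qed.

Lemma grading_decomp x : exists a b, [/\ R0 a, R1 b & x = a + b].
Proof.
case: hR => _ [e _] _.
have: [set: R] x by [].
by rewrite e => -[a ha [b hb <-]]; exists a, b.
Qed.

Lemma grading_disjoint x : R0 x -> R1 x -> x = 0.
Proof.
move=> h0 h1; case: hR => _ [_ e] _.
by have : (R0 `&` R1) x by []; rewrite e.
Qed.

Lemma grading_unique a b a' b' : R0 a -> R1 b -> R0 a' -> R1 b' ->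
  a + b = a' + b' -> a = a' /\ b = b'.
Proof.
move=> ha hb ha' hb' e.
have e' : a - a' = b' - b.
  by apply/eqP; rewrite subr_eq addrAC -addrC addrC [b' + _]addrC -e addrK.
have z : a - a' = 0.
  apply: grading_disjoint; first exact: (zmodB (grading_zmod 0)).
  by rewrite e'; exact: (zmodB (grading_zmod 1)).
split; first exact/subr0_eq.
by apply/esym/subr0_eq; rewrite -e'.
Qed.

(** With [1 = a + b], comparing degrees in [a = a a + a b] and [b = a b + b b]
    gives [a b = 0] and [b b = 0], so [b = 0]. *)
Lemma grading1 : R0 1.
Proof.
have [a [b [ha hb e]]] := grading_decomp 1.
have ab0 : a * b = 0.
  apply: grading_disjoint; last exact: gradingM01.
  have -> : a * b = a - a * a by rewrite -{2}[a]mulr1 e; ring.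
  by apply: (zmodB (grading_zmod 0)) => //; exact: gradingM00.
have bb0 : b * b = 0.
  apply: grading_disjoint; first exact: gradingM11.
  have -> : b * b = b - a * b by rewrite -{3}[b]mulr1 e; ring.
  by rewrite ab0 subr0.
have -> : 1 = a :> R.
  by rewrite e -[b]mulr1 e mulrDr bb0 mulrC ab0 !addr0.
exact: ha.
Qed.

Definition ideal_components (I0 I1 : set R) : Prop :=
  [/\ is_ideal R0 I0, zmod_closed (mem I1) /\ I1 `<=` R1,
      forall a x, R0 a -> I1 x -> I1 (a * x),
      forall a x, R1 a -> I0 x -> I1 (a * x)
    & forall a x, R1 a -> I1 x -> I0 (a * x)].

Lemma Z2_ideal_components I : Z2_ideal Rg I ->
  ideal_components (I `&` R0) (I `&` R1).
Proof.
move=> [[_ hI mI] _]; split.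
- split=> [x [] //||a x ha [Ix hx]].
    exact: zmod_closedI (grading_zmod 0).
  by split; [exact: mI|exact: gradingM00].
- by split=> [|x [] //]; exact: zmod_closedI (grading_zmod 1).
- by move=> a x ha [Ix hx]; split; [exact: mI|exact: gradingM01].
- move=> a x ha [Ix hx]; split; first exact: mI.
  by rewrite mulrC; exact: gradingM01.
- by move=> a x ha [Ix hx]; split; [exact: mI|exact: gradingM11].
Qed.

Lemma Z2_idealE I : Z2_ideal Rg I -> I = sumset (I `&` R0) (I `&` R1).
Proof. by case=> _ []. Qed.

Lemma even_part_sumset I0 I1 : ideal_components I0 I1 ->
  sumset I0 I1 `&` R0 = I0.
Proof.
move=> [[s0 _ _] [h1 s1] _ _ _]; rewrite eqEsubset; split.
  move=> _ [[a Ia [b Ib <-]] hab].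
  have [|-> _] := grading_unique hab (zmod0 (grading_zmod 1)) (s0 _ Ia) (s1 _ Ib).
    by rewrite addr0.
  by [].
by move=> x Ix; split; [exact: sumset_subl|exact: s0].
Qed.

Lemma odd_part_sumset I0 I1 : ideal_components I0 I1 ->
  sumset I0 I1 `&` R1 = I1.
Proof.
move=> [[s0 h0 _] [_ s1] _ _ _]; rewrite eqEsubset; split.
  move=> _ [[a Ia [b Ib <-]] hab].
  have [|_ ->] := grading_unique (zmod0 (grading_zmod 0)) hab (s0 _ Ia) (s1 _ Ib).
    by rewrite add0r.
  by [].
by move=> x Ix; split; [exact: sumset_subr|exact: s1].
Qed.

Lemma Z2_ideal_sumset I0 I1 : ideal_components I0 I1 ->
  Z2_ideal Rg (sumset I0 I1).
Proof.
move=> comp; rewrite /Z2_ideal even_part_sumset// odd_part_sumset//.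
have [[s0 h0 m00] [h1 s1] m01 m10 m11] := comp; split.
  split=> //; first exact: zmod_closed_sumset.
  move=> r _ _ [x Ix [y Iy <-]].
  have [a [b [ha hb ->]]] := grading_decomp r.
  exists (a * x + b * y); first by apply: (zmodD h0); [exact: m00|exact: m11].
  exists (a * y + b * x); last by ring.
  by apply: (zmodD h1); [exact: m01|exact: m10].
split=> //; rewrite eqEsubset; split.
  by move=> x [/s0 ? /s1 ?]; apply: grading_disjoint.
by move=> _ ->; split; exact: zmod0.
Qed.

Lemma Z2_ideal_proper I : Z2_ideal Rg I -> I <> setT -> I `&` R0 <> R0.
Proof.
move=> [iI _] nI e; apply: nI; apply: ideal_eq_of_one => //.
by have := grading1; rewrite -e => -[].
Qed.

(** * Graded ideals with a given even part *)

Lemma components_full p : is_ideal R0 p -> mulset R1 R1 `<=` p ->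
  ideal_components p R1.
Proof.
move=> ip sp; split=> //.
- by split=> //; exact: grading_zmod.
- exact: gradingM01.
- by case: ip => s _ _ a x ha /s hx; rewrite mulrC; exact: gradingM01.
- by move=> a x ha hx; apply/sp/mem_mulset.
Qed.

(** The least degree-one component above an even part [q], once it is required
    to contain a given [N]. *)
Lemma components_extend q N : is_ideal R0 q ->
  zmod_closed (mem N) -> N `<=` R1 ->
  (forall a x, R0 a -> N x -> N (a * x)) ->
  (forall a x, R1 a -> N x -> q (a * x)) ->
  ideal_components q (sumset N (mulset q R1)).
Proof.
move=> iq hN sN m0 m1; have [sq hq mq] := iq.
have hqR := zmod_closed_mulset R1 hq.
split=> //.
- split; first exact: zmod_closed_sumset.
  apply: sumset_sub => //; first exact: grading_zmod.
  apply: mulset_sub; first exact: grading_zmod.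
  by move=> x y /sq; exact: gradingM01.
- move=> a _ ha [x Nx [y qy <-]]; rewrite mulrDr.
  exists (a * x); first exact: m0.
  exists (a * y) => //; apply: mulset_absorb qy => // z; exact: mq.
- move=> a x ha qx; rewrite mulrC; apply: sumset_subr => //.
  exact: mem_mulset.
- move=> a _ ha [x Nx [y qy <-]]; rewrite mulrDr; apply: (zmodD hq).
    exact: m1.
  have : mulset q R1 `<=` [set y | q (a * y)].
    apply: mulset_sub; first exact: zmod_closed_preim_mul.
    move=> u v qu hv /=; rewrite mulrCA mulrC.
    by apply: mq => //; exact: gradingM11.
  exact.
Qed.

Lemma components_generated p : is_ideal R0 p ->
  ideal_components p (mulset p R1).
Proof.
move=> ip; have [_ hp _] := ip.
have := @components_extend p [set 0] ip.
have -> : sumset [set 0] (mulset p R1) = mulset p R1.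
  rewrite eqEsubset; split; first by move=> _ [_ -> [y py <-]]; rewrite add0r.
  by move=> y py; exists 0 => //; exists y => //; rewrite add0r.
apply.
- by apply/zmod_closedE; split=> // x y -> ->; rewrite subr0.
- by move=> _ ->; exact: zmod0 (grading_zmod 1).
- by move=> a _ _ ->; exact: mulr0.
- by move=> a _ _ ->; rewrite mulr0; exact: zmod0.
Qed.

(** Writing [1 = a + s] with [a] in [p] and [s] in [R1^2], an odd [x] of the
    ideal is [a x + s x], and [s x] is a sum of terms [(x b) c] with [b], [c]
    odd and [x b] in the even part [p]. *)
Lemma odd_part_generated p I1 : is_maximal R0 p -> ~ mulset R1 R1 `<=` p ->
  ideal_components p I1 -> I1 `<=` mulset p R1.
Proof.
move=> maxp np [ip [_ s1] _ _ m11] x Ix.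
have hp : zmod_closed (mem p) by case: ip.
have iR : is_ideal R0 (mulset R1 R1).
  split.
  - by apply: mulset_sub; [exact: grading_zmod|exact: gradingM11].
  - by apply: zmod_closed_mulset; exact: grading_zmod.
  - move=> a y ha; apply: mulset_absorb; first exact: grading_zmod.
    by move=> z; exact: gradingM01.
have: sumset p (mulset R1 R1) 1.
  by rewrite (maximal_comaximal (grading_zmod 0) maxp iR np); exact: grading1.
case=> a pa [s hs e].
have hpR := zmod_closed_mulset R1 hp.
rewrite -[x]mulr1 -e mulrDr; apply: (zmodD hpR).
  by rewrite mulrC; apply: mem_mulset => //; exact: s1.
have : mulset R1 R1 `<=` [set y | mulset p R1 (x * y)].
  apply: mulset_sub; first exact: zmod_closed_preim_mul.
  move=> b c hb hc /=; rewrite mulrA; apply: mem_mulset => //.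
  by rewrite mulrC; exact: m11.
exact.
Qed.

(** * Graded maximal ideals *)

Lemma graded_maximal_of_even_part p I1 : is_maximal R0 p ->
  ideal_components p I1 ->
  (forall J1, ideal_components p J1 -> J1 `<=` I1) ->
  Z2_maximal Rg (sumset p I1).
Proof.
move=> [ip np maxp] comp largest.
have even := even_part_sumset comp; have [_ [h1 s1] _ _ _] := comp.
split; first exact: Z2_ideal_sumset.
  by move=> e; apply: np; rewrite -even e setTI.
move=> J iJ sJ; have cJ := Z2_ideal_components iJ.
have sp : p `<=` J `&` R0.
  by move=> x px; split; [apply: sJ; exact: sumset_subl|case: ip => s _ _; exact: s].
have [iJ0 _ _ _ _] := cJ.
have [e|e] := maxp _ iJ0 sp; last first.
  right; apply: contrapT => nJ; exact: Z2_ideal_proper iJ nJ e.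
left; rewrite (Z2_idealE iJ) e; rewrite e in cJ; congr sumset.
rewrite eqEsubset; split; first exact: largest.
move=> x Ix; split; last exact: s1.
by apply: sJ; apply: sumset_subr => //; case: ip.
Qed.

Lemma graded_maximal_full p : is_maximal R0 p -> mulset R1 R1 `<=` p ->
  Z2_maximal Rg (sumset p R1).
Proof.
move=> maxp sp; have [ip _ _] := maxp.
apply: graded_maximal_of_even_part => //; first exact: components_full.
by move=> J1 [_ [_ s1] _ _ _].
Qed.

Lemma graded_maximal_generated p : is_maximal R0 p ->
  ~ mulset R1 R1 `<=` p -> Z2_maximal Rg (sumset p (mulset p R1)).
Proof.
move=> maxp np; have [ip _ _] := maxp.
apply: graded_maximal_of_even_part => //; first exact: components_generated.
by move=> J1; exact: odd_part_generated.
Qed.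

(** An ideal [q] of [R0] above the even part of [M] is itself the even part of
    [q + (M1 + q R1)], a graded ideal above [M]. *)
Lemma even_part_maximal M : Z2_maximal Rg M -> is_maximal R0 (M `&` R0).
Proof.
move=> [iM nM maxM].
have [iM0 [h1 s1] m01 _ m11] := Z2_ideal_components iM.
split=> //; first exact: Z2_ideal_proper.
move=> q iq sq.
have comp : ideal_components q (sumset (M `&` R1) (mulset q R1)).
  by apply: components_extend => // a x ha hx; apply/sq/m11.
have even := even_part_sumset comp.
have hq : zmod_closed (mem q) by case: iq.
have sJ : M `<=` sumset q (sumset (M `&` R1) (mulset q R1)).
  rewrite {1}(Z2_idealE iM) => _ [a /sq qa [b Mb <-]].
  exists a => //; exists b => //.
  by apply: sumset_subl Mb; apply: zmod_closed_mulset.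
have [e|e] := maxM _ (Z2_ideal_sumset comp) sJ.
  by left; rewrite -even e.
by right; rewrite -even e setTI.
Qed.

Lemma graded_maximal_eq M N : Z2_maximal Rg M -> Z2_maximal Rg N ->
  M `<=` N -> M = N.
Proof.
move=> [_ _ maxM] [iN nN _] /(maxM _ iN) [] // e; by case: nN.
Qed.

End Graded.

Theorem theorem4p5 (R : comPzRingType) (Rg : 'Z_2 -> set R)
    (hR : Z2_grading Rg) :
  let R0 := Rg 0 in
  let R1 := Rg 1 in
  Z2Max Rg =
    [set sumset p R1 | p in Max R0 `&` V R0 (mulset R1 R1)] `|`
    [set sumset p (mulset p R1) | p in Max R0 `&` D R0 (mulset R1 R1)].
Proof.
move=> R0 R1.
have prime p : is_maximal R0 p -> is_prime R0 p.
  apply: maximal_prime; [exact: grading_zmod|exact: grading1|exact: gradingM00].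
rewrite eqEsubset; split=> [M maxM|M]; last first.
  case=> -[p [maxp hp] <-].
    by apply: graded_maximal_full => //; case: hp.
  apply: graded_maximal_generated => // sp.
  by case: hp => Sp; apply.
have maxp := even_part_maximal hR maxM.
have iM : Z2_ideal Rg M by case: maxM.
have [sp|np] := pselect (mulset R1 R1 `<=` M `&` R0).
  left; exists (M `&` R0); first by split=> //; split=> //; exact: prime.
  apply/esym/(graded_maximal_eq maxM (graded_maximal_full hR maxp sp)).
  rewrite {1}(Z2_idealE iM) => _ [a Ma [b [_ hb] <-]].
  by exists a => //; exists b.
right; exists (M `&` R0).
  by split=> //; split; [exact: prime|by move=> [_ /np]].
apply: (graded_maximal_eq (graded_maximal_generated hR maxp np) maxM).
have [[_ hM mM] _] := iM.
apply: sumset_sub; [by []|by move=> x []|].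
by apply: mulset_sub => // x y [Mx _] _; rewrite mulrC; exact: mM.
Qed.
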